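(* Let $m$ be an odd positive integer and $\delta\in\mathbb{F}_{2^{2m}}$. Then $$f(x)=x+\left(\mathrm{Tr}_m^{2m}(x)^{(2^{m+1}-1)/3}+\delta\right)^3$$ is a permutation polynomial of $\mathbb{F}_{2^{2m}}$ and its compositional inverse over $\mathbb{F}_{2^{2m}}$ is $$f^{-1}(x)=x+\left(\left(\mathrm{Tr}_m^{2m}(x)+\delta^{2^{m+1}+1}+\delta^{2+2^m}\right)^{(2^{m+1}-1)/3}+\delta^{2^m}\right)^3.$$
   Context: $\mathrm{Tr}_m^{2m}(x)=x+x^{2^m}$ is the trace map from $\mathbb{F}_{2^{2m}}$ to $\mathbb{F}_{2^m}$. The compositional inverse of a permutation polynomial $F$ of a finite field $\mathbb{F}$ is the unique polynomial map $F^{-1}$ with $F(F^{-1}(x))=F^{-1}(F(x))=x$ for all $x\in\mathbb{F}$. *)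

(* Defs.v *)
From mathcomp Require Import all_boot all_order all_algebra all_field.

Set Implicit Arguments.
Unset Strict Implicit.
Unset Printing Implicit Defensive.

Import GRing.Theory.
Local Open Scope ring_scope.

Definition permutation_poly (F : finFieldType) (f : {poly F}) : Prop :=
  bijective (fun x : F => f.[x]).

(* The compositional inverse is determined only as a polynomial map, i.e. as a
   polynomial modulo 'X^#|F| - 'X (see compositional_inverse_unique), so the
   equations are pointwise rather than of the form f \Po g = 'X. *)
Definition compositional_inverse (F : finFieldType) (f g : {poly F}) : Prop :=
  (forall x : F, f.[g.[x]] = x) /\ (forall x : F, g.[f.[x]] = x).

Lemma compositional_inverse_unique (F : finFieldType) (f g h : {poly F}) :
  compositional_inverse f g -> compositional_inverse f h ->
  forall x : F, g.[x] = h.[x].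
Proof. by move=> [_ gf] [fh _] x; rewrite -[in LHS](fh x) gf. Qed.

(* When #|F| = 2 ^ (2 * m), x |-> (trace_poly F m).[x] is the trace map from F
   to its subfield with 2 ^ m elements. *)
Definition trace_poly (F : finFieldType) (m : nat) : {poly F} :=
  'X + 'X^(2 ^ m).

(* Main.v *)
Require Import Defs.
From mathcomp Require Import all_boot all_order all_algebra all_field.
From mathcomp Require Import ring zify.

(* Write q = 2 ^ m and k = (2 q - 1) / 3, so that u |-> u ^+ k inverts cubing on
   the subfield of order q.  If y = f(x), s = Tr(x) ^+ k, a = delta and
   b = delta ^+ q, then s ^+ 3 = Tr(x) and, in characteristic 2,
     Tr(y) = s ^+ 3 + (s + a) ^+ 3 + (s + b) ^+ 3
           = (s + a + b) ^+ 3 + a * b ^+ 2 + a ^+ 2 * b.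
   Hence g recovers s + a from y, and g(y) = y + (s + a) ^+ 3 = x. *)

Import GRing.Theory.
Local Open Scope ring_scope.

(** For odd [m], [2 ^ (m + 1)] is a power of 4, and 4 is 1 modulo 3. *)
Lemma dvdn3_expn2_subn1 (m : nat) : odd m -> (3 %| 2 ^ (m + 1) - 1)%N.
Proof.
move=> m_odd; rewrite -eqn_mod_dvd ?expn_gt0 //.
have ->: (m + 1 = 2 * (m + 1)./2)%N by lia.
by rewrite expnM -modnXm exp1n.
Qed.

(** Multiplying by a nonzero [u] reduces the claim to [u ^+ (2 * q) = u ^+ 2]; for [u = 0], parity
    of [2 * q] gives [3 * k != 0]. *)
Lemma expf_cube_root {F : fieldType} {q k : nat} {u : F} :
  (3 * k).+1 = (2 * q)%N -> u ^+ q = u -> u ^+ (3 * k) = u.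
Proof.
move=> kq uq; have [u0 | u_neq0] := eqVneq u 0.
  by rewrite u0 expr0n; case: (3 * k)%N kq => // /eqP; lia.
by apply: (mulfI u_neq0); rewrite -exprS kq mulnC exprM uq expr2.
Qed.

Lemma trace_cube_pchar2 (F : fieldType) (s a b : F) : 2 \in [pchar F] ->
  s ^+ 3 + (s + a) ^+ 3 + (s + b) ^+ 3 + b ^+ 2 * a + a ^+ 2 * b
    = (s + a + b) ^+ 3.
Proof.
move=> /pcharf0 two0; apply/eqP; rewrite -subr_eq0; apply/eqP.
(* Over the integers, the two sides differ by twice a polynomial. *)
transitivity ((2%:R : F) * (s ^+ 3 - a ^+ 2 * b - a * b ^+ 2 - 3%:R * s * a * b)).
  ring.
by rewrite two0 mul0r.
Qed.

Theorem theorem8 (m : nat) (F : finFieldType) (delta : F)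
    (m_gt0 : (0 < m)%N) (m_odd : odd m) (cardF : #|F| = (2 ^ (2 * m))%N) :
  let k := ((2 ^ (m + 1) - 1) %/ 3)%N in
  let f : {poly F} := 'X + (trace_poly F m ^+ k + delta%:P) ^+ 3 in
  let g : {poly F} :=
    'X + ((trace_poly F m + (delta ^+ (2 ^ (m + 1) + 1))%:P
             + (delta ^+ (2 + 2 ^ m))%:P) ^+ k
          + (delta ^+ (2 ^ m))%:P) ^+ 3 in
  permutation_poly f /\ compositional_inverse f g.
Proof.
move=> k f g.
have char2 : 2 \in [pchar F] by apply: card_finPcharP cardF _.
have frobD x y : (x + y) ^+ (2 ^ m) = x ^+ (2 ^ m) + y ^+ (2 ^ m) :> F.
  by apply: exprDn_pchar; rewrite (eq_pnat _ (pcharf_eq char2)) pnatX.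
have frobK x : x ^+ (2 ^ m) ^+ (2 ^ m) = x :> F.
  by rewrite -exprM -expnD addnn -mul2n -cardF expf_card.
have kq : (3 * k).+1 = (2 * 2 ^ m)%N.
  rewrite mulnC divnK ?dvdn3_expn2_subn1 // -expnS addn1.
  by rewrite subn1 prednK ?expn_gt0.
have fK : cancel (horner f) (horner g).
  move=> x; set t := x + x ^+ (2 ^ m); set s := t ^+ k.
  have tq : t ^+ (2 ^ m) = t by rewrite frobD frobK addrC.
  have sq : s ^+ (2 ^ m) = s by rewrite exprAC tq.
  have s3 : s ^+ 3 = t by rewrite -exprM mulnC (expf_cube_root kq).
  have fE : f.[x] = x + (s + delta) ^+ 3.
    by rewrite /f /trace_poly !hornerE.
  set b := delta ^+ (2 ^ m).
  have traceE : f.[x] + f.[x] ^+ (2 ^ m) + delta ^+ (2 ^ (m + 1) + 1)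
      + delta ^+ (2 + 2 ^ m) = (s + delta + b) ^+ 3.
    rewrite -trace_cube_pchar2 // s3 fE frobD exprAC frobD sq -/b.
    rewrite !exprD expr1 expnD exprM -/b expn1 /t.
    ring.
  (* The [2 ^ m]-th power swaps [delta] and [b], so the sum lies in the subfield where [k] inverts
     cubing. *)
  have sbq : (s + delta + b) ^+ (2 ^ m) = s + delta + b.
    by rewrite !frobD sq frobK addrAC.
  have -> : g.[f.[x]] = f.[x] + ((s + delta + b) ^+ 3 ^+ k + b) ^+ 3.
    by rewrite -traceE /g /trace_poly !hornerE.
  rewrite -exprM (expf_cube_root kq) // -addrA (addrr_pchar2 char2) addr0.
  by rewrite fE -addrA (addrr_pchar2 char2) addr0.
(* Since [F] is finite, a left inverse of [f] is two-sided. *)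
have f_bij := injF_bij (can_inj fK).
split=> //.
by split=> //; apply/(bij_can_sym f_bij).
Qed.
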